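(* Suppose $\mathcal{U}$ is an ultrafilter on $\omega$ which is Tukey reducible to a p-point. Then for each q-point $\mathcal{V}$, $\mathcal{V}\le_T\mathcal{U}$ implies $\mathcal{V}\le_{RB}\mathcal{U}$.
   Context: An ultrafilter $\mathcal{U}$ on $\omega$ is a p-point iff for every decreasing sequence $X_0\supseteq X_1\supseteq\cdots$ in $\mathcal{U}$ there is $U\in\mathcal{U}$ with $U\setminus X_n$ finite for all $n$. A q-point is a nonprincipal ultrafilter $\mathcal{V}$ on $\omega$ such that for every partition of $\omega$ into finite pieces there is $V\in\mathcal{V}$ meeting each piece in at most one point. $\mathcal{V}\le_T\mathcal{U}$ iff there is a map $f:\mathcal{U}\to\mathcal{V}$ sending every cofinal subset of $(\mathcal{U},\supseteq)$ to a cofinal subset of $(\mathcal{V},\supseteq)$. $\mathcal{V}\le_{RB}\mathcal{U}$ (Rudin–Blass) iff there is a finite-to-one $h:\omega\to\omega$ with $\mathcal{V}=h(\mathcal{U})=\{Y\subseteq\omega: h^{-1}(Y)\in\mathcal{U}\}$. *)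

(* Defs.v *)
From HB Require Import structures.
From mathcomp Require Import all_boot all_order.
From mathcomp Require Import boolp classical_sets functions cardinality filter.

Set Implicit Arguments.
Unset Strict Implicit.
Unset Printing Implicit Defensive.

Local Open Scope classical_set_scope.

(* Only q-points are required to be
   nonprincipal: principal ultrafilters count as p-points. *)
Definition p_point (U : set_system nat) : Prop :=
  UltraFilter U /\
  forall X : nat -> set nat,
    (forall n, U (X n)) -> (forall n, X n.+1 `<=` X n) ->
    exists2 A, U A & forall n, finite_set (A `\` X n).

Definition nonprincipal (U : set_system nat) : Prop :=
  forall n, U <> principal_filter n.

Definition q_point (V : set_system nat) : Prop :=
  [/\ UltraFilter V, nonprincipal V &
    forall P : set (set nat),
      partition P id [set: nat] -> (forall A, P A -> finite_set A) ->
      exists2 B, V B & forall A, P A -> is_subset1 (B `&` A)].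

Definition cofinal (U C : set_system nat) : Prop :=
  C `<=` U /\ forall A, U A -> exists2 B, C B & B `<=` A.

(* A map U -> V is a total function on sets of naturals sending members of U
   to members of V; its values outside U are irrelevant. *)
Definition tukey_le (V U : set_system nat) : Prop :=
  exists2 f : set nat -> set nat, set_fun U V f &
    forall C, cofinal U C -> cofinal V (f @` C).

Definition finite_to_one (h : nat -> nat) : Prop :=
  forall n, finite_set (h @^-1` [set n]).

Definition rudin_blass_le (V U : set_system nat) : Prop :=
  exists2 h : nat -> nat, finite_to_one h & V = fmap h U.

(* Main.v *)
(** Let W be a p-point above U.  For every nonprincipal ultrafilter Z Tukey below
    W, continuity of monotone cofinal maps on W yields a relation between indices
    j and points x, finite in both directions, such that for each B in W the set
    of indices related to some point of B belongs to Z.  Apply this to U and, as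
    V is Tukey below W by transitivity, to V, obtaining relations R and S.  Since
    V is a q-point, it has a member D so sparse that each j is linked through R
    and S to at most one n in D; sending j to this n is the required
    finite-to-one map. *)
Require Import Defs.
From mathcomp Require Import all_boot all_order.
From mathcomp Require Import boolp classical_sets functions cardinality filter.

Set Implicit Arguments.
Unset Strict Implicit.
Unset Printing Implicit Defensive.

Local Open Scope classical_set_scope.

(** * Finite sets and ultrafilters on the naturals *)

Lemma filter_bigcap_finite (T I : Type) (F : set_system T) (D : set I)
    (f : I -> set T) :
  Filter F -> finite_set D -> (forall i, D i -> F (f i)) ->
  F (\bigcap_(i in D) f i).
Proof.
move=> FF; elim/Pchoice: I => I in D f *.
move=> /finite_fsetP[X ->] Ff; exact: filter_bigI.
Qed.

Lemma finite_nat_bounded (A : set nat) :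
  finite_set A <-> exists n, A `<=` `I_n.
Proof.
split=> [finA|[n An]]; last exact: sub_finite_set An (finite_II n).
have [|n _ An] :=
    @filter_bigcap_finite _ _ \oo A (fun i => [set n | i < n]) _ finA.
  by move=> i _; exists i.+1.
by exists n => i Ai; apply: (An n _ i Ai) => /=.
Qed.

Lemma finite_subsets_I m : finite_set [set s | s `<=` `I_m].
Proof.
elim: m => [|m IHm].
  apply: (sub_finite_set _ (finite_set1 set0)) => s /= s0.
  by apply/seteqP; split=> x // /s0.
have fin2 : finite_set ([set s | s `<=` `I_m] `|`
    (setU [set m]) @` [set s | s `<=` `I_m]).
  by rewrite finite_setU; split=> //; apply: finite_image.
apply: sub_finite_set fin2 => s /= sm.
have sD x : (s `\` [set m]) x -> x < m.
  move=> [/sm /=]; rewrite ltnS leq_eqVlt => /orP[/eqP ->|//].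
  by move=> /(_ erefl).
have [ms|nms] := pselect (s m).
  by right; exists (s `\` [set m]) => //; rewrite setUC setDKU// => _ ->.
left=> x sx; apply: sD; split=> // xm; apply: nms; by rewrite -xm.
Qed.

Lemma nonprincipal_setC1 (U : set_system nat) (n : nat) :
  UltraFilter U -> nonprincipal U -> U (~` [set n]).
Proof.
move=> ultraU /(_ n) npU; have [Un|//] := in_ultra_setVsetC [set n] ultraU.
exfalso; apply: npU; apply: (@max_filter _ _ (principal_filter_ultra n)).
by move=> A /principal_filterP An; apply: filterS Un => x ->.
Qed.

(** * Tukey reductions and monotone cofinal maps *)

Lemma tukey_le_trans (V U W : set_system nat) :
  tukey_le V U -> tukey_le U W -> tukey_le V W.
Proof.
move=> [f fUV cf] [g gWU cg]; exists (f \o g).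
  by move=> A WA; apply/fUV/gWU.
by move=> C /cg /cf; rewrite image_comp.
Qed.

(** Take for [phi A] the union of all [f B] with [B] in [U] below [A]. If no [phi A] lay inside [X],
    the [B] with [f B] not inside [X] would be cofinal, yet none of their images lies inside [X]. *)
Lemma tukey_le_monotone (V U : set_system nat) :
  UltraFilter V -> tukey_le V U ->
  exists phi : set nat -> set nat,
    [/\ forall A, U A -> V (phi A),
        forall A B, A `<=` B -> phi A `<=` phi B &
        forall X, V X -> exists2 A, U A & phi A `<=` X].
Proof.
move=> ultraV [f fUV cf].
exists (fun A => \bigcup_(B in [set B | U B /\ B `<=` A]) f B); split.
- by move=> A UA; apply: filterS (fUV _ UA) => x fx; exists A => //; split.
- move=> A B AB x [C [UC CA] fCx]; exists C => //; split=> //.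
  exact: subset_trans AB.
move=> X VX; apply: contrapT => noA.
have : cofinal U [set B | U B /\ ~ f B `<=` X].
  split=> [B []//|A UA]; apply: contrapT => noB; apply: noA; exists A => //.
  move=> x [B [UB BA] fBx]; apply: contrapT => nXx; apply: noB; exists B => //.
  by split=> // /(_ _ fBx).
by move=> /cf[_ /(_ _ VX)[_ [B [_ nfB] <-] /nfB]].
Qed.

(** If [U] were principal at [n], a point of [phi [set n]] would lie in all members of [V]. *)
Lemma tukey_le_nonprincipal (V U : set_system nat) :
  UltraFilter V -> nonprincipal V -> tukey_le V U -> nonprincipal U.
Proof.
move=> ultraV npV /(tukey_le_monotone ultraV)[phi [phiV phiM phiC]] n Un.
have [|v phiv] := @filter_ex _ V _ (phi [set n]).
  by apply: phiV; rewrite Un; apply/principal_filterP.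
have [A] := phiC _ (nonprincipal_setC1 v ultraV npV).
rewrite Un => /principal_filterP An /(_ v); apply=> //.
by apply: phiM phiv => x ->.
Qed.

(** * Interval thinning and sparse members of q-points *)

(* The naturals are cut into consecutive intervals, each reaching from its left
   end past the value of g there; every other interval is discarded. *)
Lemma ultrafilter_gaps (W : set_system nat) (g : nat -> nat) :
  UltraFilter W ->
  exists2 C, W C &
    forall j, exists2 n, j <= n & forall x, C x -> n <= x -> g n <= x.
Proof.
move=> ultraW; pose k i := iter i (fun n => maxn n.+1 (g n)) 0.
have kS i : k i < k i.+1 by rewrite /= leq_max leqnn.
have k_le : {homo k : i j / i <= j}.
  by apply: homo_leq => // [? ? ?|i]; [exact: leq_trans|exact: ltnW].
have k_ge i : i <= k i by elim: i => // i IHi; apply: leq_ltn_trans IHi (kS i).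
have gk i : g (k i) <= k i.+1 by rewrite /= leq_max leqnn orbT.
pose E := [set x | exists i, k i.*2 <= x < k i.*2.+1].
have [WE|WE] := in_ultra_setVsetC E ultraW.
  exists E => // j; exists (k j.*2.+1).
    by apply: leq_trans (k_ge _); rewrite -addnn leqW ?leq_addr.
  move=> x [i /andP[kix xki]] kjx; apply: leq_trans (gk _) _.
  apply: leq_trans kix; apply: (k_le).
  have : j.*2.+1 < i.*2.+1.
    rewrite ltnNge; apply: contraTN xki => ij; rewrite -leqNgt.
    exact: leq_trans (k_le _ _ ij) kjx.
  by rewrite ltnS ltn_double -doubleS leq_double.
exists (~` E) => // j; exists (k j.*2).
  by apply: leq_trans (k_ge _); rewrite -addnn leq_addr.
move=> x nEx kjx; apply: leq_trans (gk _) _.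
by rewrite leqNgt; apply/negP => xkj; apply: nEx; exists j; rewrite kjx.
Qed.

Lemma q_point_injective (V : set_system nat) (p : nat -> nat) :
  q_point V -> finite_to_one p ->
  exists2 B, V B & forall x y, B x -> B y -> p x = p y -> x = y.
Proof.
move=> [_ _ qV] finp; have [||B VB Bp] := qV [set p @^-1` [set p x] | x in setT].
- split.
  + by apply/seteqP; split=> x // _; exists (p @^-1` [set p x]) => //; exists x.
  + by move=> _ _ [x _ <-] [y _ <-] [z [/= -> ->]].
  + by move=> _ [x _ <-]; exists x.
- by move=> _ [x _ <-]; apply: finp.
exists B => // x y Bx By pxy; apply: (Bp (p @^-1` [set p x])); by [exists x|split].
Qed.

(** Call [a] a cut if points of [C] from [a] on dominate [e i] for all [i < a]. Sending [x] to the
    next cut is finite-to-one, hence injective on some [B] in [V], so a cut separates any two points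
    of [B]. *)
Lemma q_point_sparse (V : set_system nat) (e : nat -> nat) :
  q_point V -> exists2 D, V D & forall m n, D m -> D n -> m < n -> e m <= n.
Proof.
move=> qV; have [ultraV _ _] := qV.
have [C VC gapC] := ultrafilter_gaps (fun n => \max_(i < n) e i) ultraV.
pose N := [set n | forall x, C x -> n <= x -> \max_(i < n) e i <= x].
have exN x : exists n, `[< N n >] && (x < n).
  by have [n xn Nn] := gapC x.+1; exists n; rewrite xn andbT; apply/asboolP.
pose p x := ex_minn (exN x).
have [|B VB Binj] := @q_point_injective V p qV.
  move=> v; apply/finite_nat_bounded; exists v => x /= <-.
  by rewrite /p; case: ex_minnP => n /andP[].
exists (B `&` C); first exact: filterI.
move=> m n [Bm Cm] [Bn Cn] mn.
have {Binj} : p m != p n.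
  by apply/eqP => /(Binj _ _ Bm Bn) mn'; rewrite mn' ltnn in mn.
rewrite /p; case: ex_minnP => a /andP[/asboolP Na ma] mina.
case: ex_minnP => b /andP[Nb nb] minb.
have [an _|na] := leqP a n.
  apply: leq_trans (Na _ Cn an).
  exact: (@leq_bigmax _ (fun i : 'I_a => e i) (Ordinal ma)).
rewrite eqn_leq mina ?Nb ?(ltn_trans mn nb)//= minb ?na ?andbT//.
exact/asboolP.
Qed.

(** * Continuity and forcing on p-points *)

(* G (s, j) witnesses that s does not force j into phi, and X n gathers the
   finitely many witnesses with s and j below n.  A pseudo-intersection of the
   X n need not be included in X n from n on; thinning it by ultrafilter_gaps
   achieves this for unboundedly many n. *)
Lemma p_point_continuous (W : set_system nat) (phi : set nat -> set nat) :
  p_point W -> (forall A B, A `<=` B -> phi A `<=` phi B) ->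
  exists2 A, W A & exists k : nat -> nat,
    forall j B B', W B' -> B `<=` A -> B `&` `I_(k j) `<=` B' ->
      phi B j -> phi B' j.
Proof.
move=> [ultraW pW] phiM.
have exG (i : set nat * nat) : exists Z, W Z /\
    forall Z', W Z' -> ~ phi (i.1 `|` Z') i.2 -> ~ phi (i.1 `|` Z) i.2.
  have [[Z' [WZ' nphi]]|noZ] :=
      pselect (exists Z', W Z' /\ ~ phi (i.1 `|` Z') i.2).
    by exists Z'.
  exists setT; split=> [|Z' WZ' nphi]; first exact: filterT.
  by case: noZ; exists Z'.
have [G GP] := choice exG.
pose I n := [set s : set nat | s `<=` `I_n] `*` `I_n.
pose X n := \bigcap_(i in I n) G i.
have [n|n|A0 WA0 A0X] := pW X.
- apply: filter_bigcap_finite => [|i _]; last by have [] := GP i.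
  by apply: finite_setX; [exact: finite_subsets_I|exact: finite_II].
- move=> x Xx i [iI /= in_]; apply: Xx; split=> /=; last exact: ltnW.
  by move=> y /iI /= yn; apply: ltnW.
have /choice[b bP] n : exists b, forall x, A0 x -> b <= x -> X n x.
  have /finite_nat_bounded[b Ab] := A0X n; exists b => x A0x bx.
  by apply: contrapT => nXx; have /= := Ab x (conj A0x nXx); rewrite ltnNge bx.
have [C WC gapC] := ultrafilter_gaps b ultraW.
exists (A0 `&` C); first exact: filterI.
exists (fun j => s2val (cid2 (gapC j.+1))) => j B B' WB' BA.
case: cid2 => /= n jn gapn BB' phiB; apply: contrapT => nphiB'.
(* [B] is covered by [B'] below [n] together with the witness for that part; as [n] exceeds [j],
   this witness contains [X n]. *)
have [_ /(_ B' WB')] := GP (B' `&` `I_n, j); apply => /=.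
  by apply: contra_not nphiB'; apply: phiM => x [[]|].
apply: phiM phiB => x Bx; have [A0x Cx] := BA _ Bx.
have [nx|xn] := leqP n x; last by left; split=> //; apply: BB'.
by right; apply: (bP n x A0x (gapn x Cx nx)); split=> //= y [].
Qed.

(* With T s the set of numbers that s forces into phi, R j x says that x is the
   point of B at which some number is forced for the first time, and that j is
   the number then selected.  The selected numbers form a member of U, because
   they meet phi B' for all B' below B, and phi is cofinal. *)
Lemma p_point_tukey_relation (W U : set_system nat) :
  p_point W -> UltraFilter U -> nonprincipal U -> tukey_le U W ->
  exists R : nat -> set nat,
    [/\ forall j, finite_set (R j),
        forall x, finite_set [set j | R j x] &
        forall B, W B -> U [set j | B `&` R j !=set0]].
Proof.
move=> pW ultraU npU /(tukey_le_monotone ultraU)[phi [phiU phiM phiC]].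
have ultraW : UltraFilter W by case: pW.
have [A WA [k kP]] := p_point_continuous pW phiM.
pose T (s : set nat) :=
  [set j | forall B, W B -> B `<=` A -> s `<=` B -> phi B j].
have TS s t : s `<=` t -> T s `<=` T t.
  by move=> st j Tsj B WB BA tB; apply: Tsj => //; apply: subset_trans tB.
have T0 : T set0 = set0.
  apply/seteqP; split=> // j T0j.
  have [B WB phiB] := phiC _ (nonprincipal_setC1 j ultraU npU).
  have WAB : W (A `&` B) by apply: filterI.
  have /(phiM _ B) := T0j _ WAB (@subIsetl _ _ _) (@sub0set _ _).
  by move=> /(_ (@subIsetr _ _ _)) /phiB /(_ erefl).
have Tk s j : s `<=` A -> T s j -> T (s `&` `I_(k j)) j.
  move=> sA Tsj B WB BA sB.
  apply: (kP j (B `|` s)) => // [x [/BA|/sA]//|x [[//|sx] xk]|].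
    by apply: sB; split.
  apply: Tsj => [|x [/BA|/sA]//|x sx]; last by right.
  by apply: filterS WB => x; left.
(* The default 0 never matters, as [first] requires [T s] to be nonempty. *)
pose f s := xget 0 (T s).
pose first s x := [/\ s `<=` A, s `<=` `I_x.+1, s x, T s !=set0 &
  T (s `&` `I_x) = set0].
exists (fun j => [set x | exists2 s, first s x & f s = j]); split.
- move=> j; apply/finite_nat_bounded; exists (k j) => x /= [s [sA sx _ Ts Tsx] fs].
  have Tsj : T s j by rewrite -fs; apply: xgetPex.
  rewrite ltnNge; apply/negP => kx.
  suff : T (s `&` `I_x) j by rewrite Tsx.
  apply: TS (Tk _ _ sA Tsj) => y [sy /= yk]; split=> //=.
  exact: leq_trans kx.
- move=> x; have := finite_image f (finite_subsets_I x.+1).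
  by apply: sub_finite_set => j [s [_ sx _ _ _] <-]; exists s.
move=> B0 WB0; set S := [set j | _].
have [//|/phiC[B1 WB1 phiB1]] := in_ultra_setVsetC S ultraU.
pose B := A `&` (B0 `&` B1).
have WB : W B by do 2 apply: filterI => //.
have BA : B `<=` A by move=> x [].
have [j phij] := @filter_ex _ U _ _ (phiU _ WB).
have exx : exists x, `[< T (B `&` `I_x) !=set0 >].
  exists (k j); apply/asboolP; exists j => B' WB' B'A BB'.
  exact: kP phij.
(* The shortest initial segment of [B] that forces a number ends at a point [x] of [B]. *)
case: (ex_minnP exx) => -[|x] /asboolP Tx minx.
  by move: Tx; rewrite II0 setI0 T0 => -[].
exfalso.
have Txx : T (B `&` `I_x) = set0.
  apply/eqP/negPn/negP => /set0P Tx'.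
  by have := minx x (introT (asboolP _) Tx'); rewrite ltnn.
have Bx : B x.
  apply: contrapT => nBx; move: Tx; suff -> : B `&` `I_x.+1 = B `&` `I_x.
    by rewrite Txx => -[].
  apply/seteqP; split=> y [By /= yx]; split=> //=; last exact: ltnW.
  move: yx; rewrite ltnS leq_eqVlt => /orP[/eqP yx|//].
  by rewrite yx in By.
have Tf : T (B `&` `I_x.+1) (f (B `&` `I_x.+1)) by apply: xgetPex.
apply: (phiB1 (f (B `&` `I_x.+1))).
  by apply: phiM (Tf B WB BA (@subIsetl _ _ _)) => y [_ []].
exists x; split; first by case: Bx => ? [].
exists (B `&` `I_x.+1) => //; split=> //.
- by move=> y [/BA].
- by split=> //=.
rewrite -setIA; suff -> : `I_x.+1 `&` `I_x = `I_x by [].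
by apply/seteqP; split=> y /= => [[]//|yx]; split=> //; apply: ltnW.
Qed.

Theorem theorem2p7 (U : set_system nat) (ultraU : UltraFilter U)
    (U_le_p : exists2 W : set_system nat, p_point W & tukey_le U W)
    (V : set_system nat) (qV : q_point V) :
  tukey_le V U -> rudin_blass_le V U.
Proof.
move=> VU; have [W pW UW] := U_le_p.
have [ultraV npV _] := qV; have ultraW : UltraFilter W by case: pW.
have npU := tukey_le_nonprincipal ultraV npV VU.
have [R [finR finR' UR]] := p_point_tukey_relation pW ultraU npU UW.
have [S [finS finS' VS]] :=
  p_point_tukey_relation pW ultraV npV (tukey_le_trans VU UW).
pose E (j : nat) := [set n | R j `&` S n !=set0].
have finE' n : finite_set [set j | E j n].
  have := bigcup_finite (finS n) (fun x _ => finR' x).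
  by apply: sub_finite_set => j [x [Rjx Snx]]; exists x.
have finE j : finite_set (E j).
  have := bigcup_finite (finR j) (fun x _ => finS' x).
  by apply: sub_finite_set => n [x [Rjx Snx]]; exists x.
(* [e n] exceeds every [n'] sharing an index [j] with [n]. *)
have /choice[e eP] n : exists e, forall j n', E j n -> E j n' -> n' < e.
  have /finite_nat_bounded[e eP] := bigcup_finite (finE' n) (fun j _ => finE j).
  by exists e => j n' Ejn Ejn'; apply: eP; exists j.
have [D VD De] := q_point_sparse e qV.
have E1 j m n : D m -> D n -> E j m -> E j n -> m = n.
  move=> Dm Dn Ejm Ejn; case: (ltngtP m n) => // lt.
  - by have := De _ _ Dm Dn lt; rewrite leqNgt (eP m j).
  - by have := De _ _ Dn Dm lt; rewrite leqNgt (eP n j).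
(* An index without partner in [D] is sent to itself, adding at most one point to each fibre. *)
pose g j := xget j (D `&` E j).
exists g.
  move=> n; have : finite_set ([set j | E j n] `|` [set n]).
    by rewrite finite_setU; split.
  apply: sub_finite_set => j; rewrite /= /g.
  by case: xgetP => [m _ [_ Ejm] <-|_ ->]; [left|right].
apply/esym/(@max_filter _ V _ (fmap g U)) => Y VY.
pose B := \bigcup_(n in Y `&` D) S n.
have WB : W B.
  (* Otherwise the complement of [B] would meet [S n] for some [n] in both [Y] and [D], while this
     [S n] lies inside [B]. *)
  have [//|/VS VB] := in_ultra_setVsetC B ultraW; exfalso.
  have /filter_ex[n [[x [nBx Snx]] [Yn Dn]]] :
      V ([set n | ~` B `&` S n !=set0] `&` (Y `&` D)).
    by do 2 apply: filterI => //.
  by apply: nBx; exists n.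
suff : [set j | B `&` R j !=set0] `<=` g @^-1` Y.
  by move=> /filterS; apply; apply: UR.
move=> j [x [[n [Yn Dn] Snx] Rjx]] /=.
have Ejn : E j n by exists x.
rewrite /g; case: xgetP => [m _ [Dm Ejm]|/(_ n)]; first by rewrite (E1 j m n).
by case; split.
Qed.
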